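(* Let $X$ and $Y$ be Polish spaces and let $\mathcal{F}\subseteq Y^X$ be a family of functions from $X$ to $Y$. The game $G'_{\mathcal{F}}$ is determined (i.e. one of the two players has a winning strategy), and \begin{itemize} \item Player I has a winning strategy in $G'_{\mathcal{F}}$ if and only if $\mathcal{F}$ is not equi-Baire 1; \item Player II has a winning strategy in $G'_{\mathcal{F}}$ if and only if $\mathcal{F}$ is equi-Baire 1. \end{itemize}
   Context: $X$ and $Y$ are Polish spaces with fixed compatible complete metrics $d_X$ and $d_Y$. A family $\mathcal{F}\subseteq Y^X$ is equi-Baire 1 if for every $\varepsilon>0$ there is a function $\delta_\varepsilon\colon X\to(0,\infty)$ such that for all $x_0,x_1\in X$ and all $f\in\mathcal{F}$: $d_X(x_0,x_1)<\min\{\delta_\varepsilon(x_0),\delta_\varepsilon(x_1)\}$ implies $d_Y(f(x_0),f(x_1))<\varepsilon$. The game $G'_{\mathcal{F}}$: at step $n\in\mathbb{N}=\{0,1,2,\dots\}$ Player I plays $x_n$ and then Player II plays $x'_n$ (order of moves: $x_0,x'_0,x_1,x'_1,\dots$), with the rules that for each $n$: $x_n\in X$ and $d_X(x_n,x_{n+1})\le 2^{-n}$; and $x'_n\in X$. Since $X$ is complete, $x_n\to x$ for some $x\in X$. Player II wins if $$\forall_{\varepsilon>0}\ \exists_{N\in\mathbb{N}}\ \forall_{n\ge N}\ \forall_{f\in\mathcal{F}}\quad d_Y(f(x'_n),f(x))<\varepsilon;$$ otherwise Player I wins. The rules are binding: the first player who does not make a legal move loses. The Axiom of Choice is assumed.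 *)

(* Defs.v *)
From HB Require Import structures.
From mathcomp Require Import all_boot all_order all_algebra.
From mathcomp Require Import all_classical all_reals all_analysis.

Set Implicit Arguments.
Unset Strict Implicit.
Unset Printing Implicit Defensive.

Import Order.TTheory GRing.Theory Num.Theory.

Local Open Scope classical_set_scope.
Local Open Scope ring_scope.

(* A Polish space together with a fixed compatible complete metric is a
   metricType satisfying this predicate: its topology is the one induced by
   mdist.  completePseudoMetricType is not used because it requires a
   distinguished point, whereas the empty Polish space is allowed here. *)
Definition polish_metric (R : realType) (X : metricType R) : Prop :=
  (forall u : nat -> X, cauchy (u @ \oo) -> exists l : X, u @ \oo --> l) /\
  (exists2 D : set X, countable D & dense D).

Definition equi_Baire1 (R : realType) (X Y : metricType R)
    (F : set (X -> Y)) : Prop :=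
  forall eps : R, 0 < eps ->
    exists delta : X -> R, (forall x, 0 < delta x) /\
      forall (x0 x1 : X) (f : X -> Y), F f ->
        mdist x0 x1 < Num.min (delta x0) (delta x1) ->
        mdist (f x0) (f x1) < eps.

Section Game.
Variables (R : realType) (X Y : metricType R) (F : set (X -> Y)).

Definition legal_I (x : nat -> X) : Prop := forall n, mdist (x n) (x n.+1) <= 2 ^- n.

(* Every move of Player II in X is legal, so only Player I can break the rules.
   A game that stops because Player I makes an illegal move is represented by
   any infinite run extending it; Player II wins all of these. *)
Definition II_wins (x x' : nat -> X) : Prop :=
  legal_I x -> exists2 l : X, x @ \oo --> l &
    forall eps : R, 0 < eps -> exists N, forall n, (N <= n)%N ->
      forall f, F f -> mdist (f (x' n)) (f l) < eps.

Definition I_wins (x x' : nat -> X) : Prop := ~ II_wins x x'.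

Definition history (x x' : nat -> X) (n : nat) : seq (X * X) :=
  mkseq (fun i => (x i, x' i)) n.

(* If X is empty then strategy_I is empty (Player I cannot move, hence loses)
   while strategy_II is inhabited. *)
Definition strategy_I := seq (X * X) -> X.
Definition strategy_II := seq (X * X) -> X -> X.

Definition winning_I (s : strategy_I) : Prop :=
  forall x x', (forall n, x n = s (history x x' n)) -> I_wins x x'.

Definition winning_II (t : strategy_II) : Prop :=
  forall x x', (forall n, x' n = t (history x x' n) (x n)) -> II_wins x x'.

Definition I_has_winning_strategy : Prop := exists s, winning_I s.
Definition II_has_winning_strategy : Prop := exists t, winning_II t.

Definition determined : Prop :=
  I_has_winning_strategy \/ II_has_winning_strategy.

End Game.

(* Main.v *)
Require Import Defs.
From HB Require Import structures.
From mathcomp Require Import all_boot all_order all_algebra.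
From mathcomp Require Import all_classical all_reals all_analysis.
From mathcomp Require Import lra.

(** Put on [X] the (possibly infinite) pseudometric
    [sup_(f in F) mdist (f x) (f y)]. Player II wins a run exactly when the
    points [x' n] converge to the limit [l] of the [x n] for this pseudometric,
    and [F] is equi-Baire 1 exactly when for each [eps] some gauge [delta]
    forces pairs that are closer than both their gauges to be [eps]-close for
    it.

    If [F] is equi-Baire 1, Player II knows after [x n] that the limit lies in
    the closed ball of radius [2 * 2^-n] around [x n], and any two points of
    that ball are at distance at most [4 * 2^-n]. Player II answers with a point
    of the ball whose gauges for [eps = 1, 1/2, ..., 1/n] exceed [4 * 2^-n] for
    as many initial values of [eps] as some point of the ball allows. For large
    [n] the limit itself has its first [k] gauges above [4 * 2^-n], so [x' n]
    does as well, and the definition of a gauge makes [x' n] and the limit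
    [1/k]-close ([equi_Baire1_II_wins]).

    If [F] is not equi-Baire 1, there are [c > 0] and a nonempty set [C] such
    that each point of [C] has points of [C] arbitrarily near it that are not
    [c]-close to it. This is the contrapositive of [fragmented_equi_Baire1]: if
    every nonempty set has a relatively open nonempty piece of small
    oscillation, a transfinite removal of such pieces exhausts [X], and the room
    left around each point at the stage where it is removed is a gauge. Player I
    stays at a point of [C] until Player II answers with a point close to it,
    then jumps to a very near point of [C] that is not [c]-close to it, and
    starts again. With finitely many jumps Player II is never again close to the
    limit; with infinitely many, the answers of Player II come close to
    successive positions that are far apart, so they do not converge
    ([not_equi_Baire1_I_wins]).

    Two winning strategies cannot coexist, since they could be played against
    each other; this gives the two converse implications. *)

Set Implicit Arguments.
Unset Strict Implicit.
Unset Printing Implicit Defensive.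

Import Order.TTheory GRing.Theory Num.Theory.

Local Open Scope classical_set_scope.
Local Open Scope ring_scope.

(** A strict bound for every single [f] replaces a bound on the supremum: this
    is the form in which the pseudometric occurs in [equi_Baire1] and
    [II_wins]. *)
Definition uclose (R : realType) (X Y : metricType R) (F : set (X -> Y))
  (c : R) (x y : X) : Prop := forall f, F f -> mdist (f x) (f y) < c.

Lemma uclose_sym (R : realType) (X Y : metricType R) (F : set (X -> Y))
  (c : R) (x y : X) : uclose F c x y -> uclose F c y x.
Proof. by move=> h f Ff; rewrite metric_sym; exact: h. Qed.

Lemma uclose_trans (R : realType) (X Y : metricType R) (F : set (X -> Y))
  (c d : R) (x y z : X) :
  uclose F c x y -> uclose F d y z -> uclose F (c + d) x z.
Proof.
move=> xy yz f Ff; apply: le_lt_trans (metric_triangle _ (f y) _) _.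
by apply: ltrD; [exact: xy|exact: yz].
Qed.

Lemma inv_pow2_lt_eventually (R : realType) (e : R) : 0 < e ->
  exists N, forall n, (N <= n)%N -> 2 ^- n < e.
Proof.
move=> e0; have [N _ HN] := near_infty_natSinv_expn_lt (PosNum e0).
exists N => n Nn; have := HN n Nn.
by rewrite /= mul1r.
Qed.

Lemma cvg_mdist (R : realType) (X : metricType R) (x : nat -> X) (l : X) :
  x @ \oo --> l <->
  forall e : R, 0 < e -> exists N, forall n, (N <= n)%N -> mdist l (x n) < e.
Proof.
split=> [xl e e0|h].
  have [N _ HN] := metricType_numDomainType.cvgr_dist_lt xl e0.
  by exists N => n Nn; exact: HN.
apply/metricType_numDomainType.cvgrPdist_lt => e e0.
by have [N HN] := h _ e0; exists N.
Qed.

(** The tail of the geometric series is kept exact, rather than bounded by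
    [2 * 2^-n], because this is what makes the induction on [k] close. *)
Lemma legal_tail (R : realType) (X : metricType R) (x : nat -> X) n k :
  legal_I x -> mdist (x n) (x (n + k)%N) <= 2 * 2 ^- n - 2 * 2 ^- (n + k).
Proof.
move=> lx; elim: k => [|k ih]; first by rewrite addn0 mdistxx subrr.
apply: le_trans (metric_triangle _ (x (n + k)%N) _) _.
have := lx (n + k)%N; rewrite addnS.
have : (2 : R) ^- (n + k) = 2 * 2 ^- (n + k).+1.
  by rewrite exprS invfM mulrA divff ?mul1r.
lra.
Qed.

Lemma legal_limit (R : realType) (X : metricType R) (x : nat -> X) (l : X) n :
  legal_I x -> x @ \oo --> l -> mdist (x n) l <= 2 * 2 ^- n.
Proof.
move=> lx /cvg_mdist xl; apply/ler_addgt0Pr => e e0.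
have [N HN] := xl _ e0.
have := HN _ (leq_addl n N); have := legal_tail n N lx.
have := metric_triangle (x n) (x (n + N)%N) l.
have := metric_sym (x (n + N)%N) l.
have : (0 : R) < 2 ^- (n + N) by rewrite invr_gt0 exprn_gt0.
lra.
Qed.

Lemma legal_cvg (R : realType) (X : metricType R) (x : nat -> X) :
  polish_metric X -> legal_I x -> exists l : X, x @ \oo --> l.
Proof.
move=> [cX _] lx; apply: cX; apply: cauchy_exP => e e0.
have [N HN] := @inv_pow2_lt_eventually _ (e / 2) (divr_gt0 e0 (ltr0Sn _ _)).
exists (x N); exists N => // n /= Nn.
rewrite ballEmdist /= -(subnKC Nn).
have := legal_tail N (n - N) lx; have := HN _ (leqnn N).
have : (0 : R) < 2 ^- (N + (n - N)) by rewrite invr_gt0 exprn_gt0.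
lra.
Qed.

(** The pieces provided by the hypothesis are removed from [X] one after the
    other. Instead of an ordinal recursion, Zorn's lemma is applied to graphs
    [G] of partial gauges; a maximal one is total, as otherwise the complement
    of its domain contains a further piece. A ball whose radius is the gauge of
    its centre stays inside the domain. This is what makes a partial gauge
    extendable: an old point and a new one are never closer than the old gauge,
    so only pairs of new points, which lie in a common piece, have to be
    compared. *)
Lemma fragmented_equi_Baire1 (R : realType) (X Y : metricType R)
    (F : set (X -> Y)) :
  (forall (c : R) (C : set X), 0 < c -> C !=set0 ->
     exists2 x, C x & exists2 r : R, 0 < r &
       forall y, C y -> mdist x y < r -> uclose F c x y) ->
  equi_Baire1 F.
Proof.
move=> frag eps eps0.
pose P (G : set (X * R)) := [/\
  forall x r, G (x, r) -> 0 < r,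
  forall x r y, G (x, r) -> mdist x y < r -> exists s, G (y, s) &
  forall x r y s, G (x, r) -> G (y, s) -> mdist x y < Num.min r s ->
    uclose F eps x y].
have [G [[Gpos Gopen Gclose] Gmax]] :
    exists G, P G /\ forall H, G `<` H -> ~ P H.
  apply: Zorn_bigcup => A AP Atot; split.
  - by move=> x r [G AG]; have [+ _ _] := AP _ AG; apply.
  - move=> x r y [G AG Gx] xy; have [_ /(_ _ _ _ Gx xy)[s Gs] _] := AP _ AG.
    by exists s, G.
  - move=> x r y s [G AG Gx] [H AH Hy].
    have [GH|HG] := Atot _ _ AG AH.
      by have [_ _] := AP _ AH; apply=> //; exact: GH.
    by have [_ _] := AP _ AG; apply=> //; exact: HG.
have Gtotal x : exists r, G (x, r).
  apply: contrapT => Nx.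
  pose C := [set y | ~ exists r, G (y, r)].
  (* Two new points are compared through [z], which costs a factor of 2. *)
  have c0 : 0 < eps / 2 by rewrite divr_gt0.
  have [z Cz [r r0 zr]] := frag _ C c0 (ex_intro _ x Nx).
  (* The radius left around [y] keeps the gauge ball of [y] inside the ball
     of radius [r] around [z], hence inside the enlarged domain. *)
  pose B : set (X * R) :=
    [set p | [/\ C p.1, mdist z p.1 < r & p.2 = r - mdist z p.1]].
  apply: (Gmax (G `|` B)).
    split; first by move=> p; left.
    move=> BG; apply: (Cz); exists r; apply: BG; right.
    by split => //=; rewrite mdistxx ?subr0.
  split.
  - by move=> y s [/Gpos//|[/= _ ? ->]]; rewrite subr_gt0.
  - move=> y s w [Gy|[/= Cy zy ->]] yw.
      by have [t Gt] := Gopen _ _ _ Gy yw; exists t; left.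
    have [[t Gt]|Cw] := pselect (exists t, G (w, t)); first by exists t; left.
    exists (r - mdist z w); right; split => //=.
    by have := metric_triangle z y w; lra.
  - move=> y s w t [Gy|[/= Cy zy ->]] [Gw|[/= Cw zw ->]].
    + exact: Gclose Gy Gw.
    + by rewrite lt_min => /andP[/(Gopen _ _ _ Gy)/Cw].
    + by rewrite lt_min metric_sym => /andP[_ /(Gopen _ _ _ Gw)/Cy].
    + move=> _; rewrite (splitr eps); apply: (@uclose_trans _ _ _ _ _ _ _ z).
        by apply: uclose_sym; exact: zr.
      exact: zr.
have [delta Gdelta] := choice Gtotal.
exists delta; split=> [x|x y f Ff xy]; first exact: Gpos (Gdelta x).
exact: Gclose (Gdelta x) (Gdelta y) xy f Ff.
Qed.

(** The strategy depends only on the last exchange and on the number of moves: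
    jump if the answer was close to the current position, stay otherwise. If
    Player II won, the answers would be close to the limit from some point on.
    Then each later position would be close to the limit too: the position does
    not change until an answer close to it arrives, and such an answer must
    arrive, as otherwise the position would itself be the limit. The two ends
    of a jump would thus be close to each other. *)
Lemma not_equi_Baire1_I_wins (R : realType) (X Y : metricType R)
    (F : set (X -> Y)) : ~ equi_Baire1 F -> I_has_winning_strategy F.
Proof.
move=> nF.
have [c [C [c0 [x0 Cx0] jump]]] : exists (c : R) (C : set X),
    [/\ 0 < c, C !=set0 & forall x (r : R), C x -> 0 < r ->
      exists y, [/\ C y, mdist x y < r & ~ uclose F c x y]].
  apply: contrapT => nC; apply: nF; apply: fragmented_equi_Baire1 => c C c0 C0.
  apply: contrapT => nx; apply: nC; exists c, C; split => // x r Cx r0.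
  apply: contrapT => ny; apply: nx; exists x => //; exists r => // y Cy xy.
  by apply: contrapT => nxy; apply: ny; exists y.
have /choice[J HJ] : forall p : X * nat, exists y, C p.1 ->
    [/\ C y, mdist p.1 y < 2 ^- p.2 & ~ uclose F c p.1 y].
  move=> [x n]; have [Cx|nCx] := pselect (C x); last by exists x.
  have r0 : (0 : R) < 2 ^- n by rewrite invr_gt0 exprn_gt0.
  by have [y Hy] := jump x _ Cx r0; exists y.
(* The two ends of a jump are joined through an answer, the limit and another
   answer: four steps of size [d]. *)
pose d := c / 4; have d0 : 0 < d by rewrite divr_gt0.
pose s (h : seq (X * X)) :=
  if size h is n.+1 then
    let q := last (x0, x0) h in
    if `[< uclose F d q.2 q.1 >] then J (q.1, n) else q.1
  else x0.
exists s => x x' run win.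
have xS n : x n.+1 =
    if `[< uclose F d (x' n) (x n) >] then J (x n, n) else x n.
  by rewrite (run n.+1) /history mkseqS /s size_rcons last_rcons size_mkseq.
have Cx n : C (x n).
  elim: n => [|n ih]; first by rewrite run.
  by rewrite xS; case: asboolP => // _; have [] := HJ (x n, n) ih.
have xfar n : uclose F d (x' n) (x n) -> ~ uclose F c (x n) (x n.+1).
  by move=> h; rewrite xS asboolT //; have [] := HJ (x n, n) (Cx n).
have xstay n : ~ uclose F d (x' n) (x n) -> x n.+1 = x n.
  by move=> h; rewrite xS asboolF.
have legal : legal_I x.
  move=> n; rewrite xS; case: asboolP => _.
    by have [_ /ltW] := HJ (x n, n) (Cx n).
  by rewrite mdistxx invr_ge0 exprn_ge0.
have [l xl /(_ _ d0)[N HN]] := win legal.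
(* The position at time [n] persists until an answer close to it arrives. *)
have next n : (N <= n)%N ->
    exists2 m, (N <= m)%N & x m = x n /\ uclose F d (x' m) (x m).
  move=> Nn; apply: contrapT => nm.
  have xconst k : x (n + k)%N = x n.
    elim: k => [|k ih]; first by rewrite addn0.
    rewrite addnS xstay // => h; apply: nm; exists (n + k)%N => //.
    by rewrite (leq_trans Nn) ?leq_addr.
  have ln : l = x n.
    apply/eqP; rewrite -[_ == _]negbK -mdist_gt0; apply/negP => ln.
    have [M HM] := (cvg_mdist x l).1 xl _ ln.
    by have := HM _ (leq_addl n M); rewrite xconst ltxx.
  apply: nm; exists n => //; split => //; rewrite -ln; exact: HN.
have near_l n : (N <= n)%N -> uclose F (d + d) (x n) l.
  move=> /next[m Nm [<- h]]; apply: uclose_trans (uclose_sym h) _.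
  exact: HN.
have [m Nm [_ h]] := next N (leqnn N).
apply: (xfar m h).
have -> : c = (d + d) + (d + d) by rewrite /d; lra.
by apply: uclose_trans (near_l _ Nm) _; apply/uclose_sym/near_l/leqW.
Qed.

(** Any point of the last nonempty set among the first ones will do, as the sets
    decrease. Player II uses it to serve as many tolerances at once as
    possible, without knowing how many the limit will allow. *)
Lemma exists_mem_nonempty_terms (T : Type) (P : nat -> set T) (n : nat) :
  P 0%N !=set0 -> (forall m, P m.+1 `<=` P m) ->
  exists y, forall m, (m <= n)%N -> P m !=set0 -> P m y.
Proof.
move=> [y0 Py0] Pdec.
have Pmono m k : (m <= k)%N -> P k `<=` P m.
  move=> /subnKC <-; elim: (k - m)%N => [|j ih]; first by rewrite addn0.
  by rewrite addnS; apply: subset_trans (Pdec _) ih.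
elim: n => [|n [y Hy]]; first by exists y0 => m; rewrite leqn0 => /eqP ->.
have [[z Pz]|nP] := pselect (P n.+1 !=set0).
  by exists z => m mn _; exact: Pmono mn _ Pz.
by exists y => m; rewrite leq_eqVlt => /orP[/eqP -> /nP|]//; exact: Hy.
Qed.

(** The constant [4] in [P] is forced by the ball of radius [2 * 2^-n], in which
    both the answer and the limit lie. As the limit belongs to [P n (x n) k.+1]
    for large [n], this set is nonempty and the answer belongs to it; both
    gauges of index [k] then exceed the distance from the answer to the
    limit. *)
Lemma equi_Baire1_II_wins (R : realType) (X Y : metricType R)
    (F : set (X -> Y)) :
  polish_metric X -> equi_Baire1 F -> II_has_winning_strategy F.
Proof.
move=> hX eB.
have /choice[delta Hdelta] : forall k : nat, exists delta : X -> R,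
    (forall x, 0 < delta x) /\ forall x y : X,
      mdist x y < Num.min (delta x) (delta y) -> uclose F k.+1%:R^-1 x y.
  move=> k; have k0 : (0 : R) < k.+1%:R^-1 by rewrite invr_gt0.
  have [delta [dpos dF]] := eB _ k0; exists delta; split => // x y xy f Ff.
  exact: dF.
pose P (n : nat) (x : X) (m : nat) : set X :=
  [set y | mdist x y <= 2 * 2 ^- n /\
    forall j, (j < m)%N -> 4 * 2 ^- n < delta j y].
have /choice[t Ht] : forall p : nat * X, exists y,
    forall m, (m <= p.1)%N -> P p.1 p.2 m !=set0 -> P p.1 p.2 m y.
  move=> [n x] /=; apply: exists_mem_nonempty_terms.
    by exists x; split=> //; rewrite mdistxx mulr_ge0 // invr_ge0 exprn_ge0.
  by move=> m y [xy Hy]; split=> // j jm; apply: Hy; exact: leqW.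
exists (fun h x => t (size h, x)) => x x' run legal.
have {}run n : x' n = t (n, x n) by rewrite run size_mkseq.
have [l xl] := legal_cvg hX legal.
exists l => // eps eps0.
have [k _ Hk] := near_infty_natSinv_lt (PosNum eps0).
have [N HN] : exists N, forall n, (N <= n)%N ->
    forall j, (j < k.+1)%N -> 4 * 2 ^- n < delta j l.
  elim: k.+1 => [|m [N HN]]; first by exists 0%N.
  have [M HM] := @inv_pow2_lt_eventually _ (delta m l / 4)
     (divr_gt0 ((Hdelta m).1 l) (ltr0Sn _ _)).
  exists (maxn N M) => n; rewrite geq_max => /andP[Nn Mn] j.
  rewrite ltnS leq_eqVlt => /orP[/eqP ->|]; last exact: HN.
  by have := HM _ Mn; lra.
exists (maxn N k.+1) => n; rewrite geq_max => /andP[Nn kn] f Ff.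
have Pl : P n (x n) k.+1 l by split; [exact: legal_limit|exact: HN].
have [xx' Hx'] := Ht (n, x n) _ kn (ex_intro _ l Pl).
rewrite /= -run in xx' Hx'.
apply: lt_trans (Hk k (leqnn k)).
apply: (Hdelta k).2 => //.
have /= := Hx' k (ltnSn k); have /= := HN n Nn k (ltnSn k).
have := metric_triangle (x' n) (x n) l; have := legal_limit n legal xl.
have := metric_sym (x' n) (x n).
move=> e1 e2 e3 e4 e5; rewrite lt_min; apply/andP; split; lra.
Qed.

(** Playing the two strategies against each other gives a run that both players
    would win. *)
Lemma not_both_win (R : realType) (X Y : metricType R) (F : set (X -> Y)) :
  I_has_winning_strategy F -> II_has_winning_strategy F -> False.
Proof.
move=> [s sw] [t tw].
pose h := fix h n : seq (X * X) :=
  if n is m.+1 then rcons (h m) (s (h m), t (h m) (s (h m))) else [::].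
pose x n := s (h n); pose x' n := t (h n) (x n).
have hE n : history x x' n = h n.
  by elim: n => // n ih; rewrite /history mkseqS -/(history x x' n) ih.
by apply: (sw x x') => [n|]; [|apply: (tw x x') => n]; rewrite hE.
Qed.

Theorem theorem8 (R : realType) (X Y : metricType R)
    (hX : polish_metric X) (hY : polish_metric Y)
    (F : set (X -> Y)) :
  determined F /\
  (I_has_winning_strategy F <-> ~ equi_Baire1 F) /\
  (II_has_winning_strategy F <-> equi_Baire1 F).
Proof.
have II_of := @equi_Baire1_II_wins R X Y F hX.
have I_of := @not_equi_Baire1_I_wins R X Y F.
have excl := @not_both_win R X Y F.
split; first by have [/II_of|/I_of] := pselect (equi_Baire1 F); [right|left].
split; split=> //; first by move=> I_win /II_of; exact: excl.
by move=> II_win; apply: contrapT => /I_of I_win; exact: excl.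
Qed.
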